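(* Let $J\ge2$, $\beta\in(0,1)^J$ with $\sum_i\beta_i=1$, let $\pi$ be the GPS projection operator and $\overline\Gamma$ the GPS extended Skorokhod map associated with $\beta$. If $\tilde\nu,\nu\in\mathbb R^J$ satisfy $\tilde\nu\le\nu$, then $$\pi(\tilde\nu)\le\pi(\nu).$$ Moreover, if for $\tilde\psi,\psi\in\mathcal D([0,\infty):\mathbb R^J)$ with $\tilde\psi(0),\psi(0)\in\mathbb R_+^J$ there exists a coordinate-wise nondecreasing function $\Delta:[0,\infty)\to\mathbb R^J$ with $\Delta(0)\ge0$ such that $\psi(t)=\tilde\psi(t)+\Delta(t)$ for every $t\in[0,\infty)$, then $$\overline\Gamma(\tilde\psi)(t)\le\overline\Gamma(\psi)(t)\qquad\text{for every }t\in[0,\infty).$$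
   Context: $\mathcal I=\{1,\dots,J\}$; $e_i$ standard basis of $\mathbb R^J$; vector inequalities are componentwise; $\mathcal D([0,\infty):\mathbb R^J)$ is the space of right-continuous functions with left limits. **Directions of constraint.** $d_{J+1}=\sum_{i\in\mathcal I}e_i/\sqrt J$ and $d_i=e_i-\sum_{j\in\mathcal I\setminus\{i\}}\frac{\beta_j}{1-\beta_i}e_j$ for $i\in\mathcal I$. For $x\in\mathbb R_+^J$, let $I(x)=\{i\in\mathcal I:x_i=0\}$ if $x\neq0$, $I(0)=\mathcal I\cup\{J+1\}$, and $d(x)=\{\sum_{i\in I(x)}a_id_i:a_i\ge0\}$ (so $d(x)=\{0\}$ in the interior). **Projection.** $\pi:\mathbb R^J\to\mathbb R_+^J$ is the (well-defined) map characterized by $\pi(x)=x$ if $x\in\mathbb R_+^J$, and $\pi(x)\in\partial\mathbb R_+^J$, $\pi(x)-x\in d(\pi(x))$ if $x\notin\mathbb R_+^J$. **GPS extended Skorokhod problem (ESP).** For $\psi\in\mathcal D([0,\infty):\mathbb R^J)$ with $\psi(0)\in\mathbb R_+^J$, $(\varphi,\eta)$ solves the ESP for $\psi$ if $\varphi(0)=\psi(0)$ and for all $t\ge0$: $\varphi(t)=\psi(t)+\eta(t)$; $\varphi(t)\in\mathbb R_+^J$; for every $s\in[0,t]$, $\eta(t)-\eta(s)\in\overline{\mathrm{co}}\big[\bigcup_{u\in(s,t]}d(\varphi(u))\big]$ (closed convex hull); and $\eta(t)-\eta(t-)\in\overline{\mathrm{co}}[d(\varphi(t))]$. A unique solution exists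 for every such $\psi$, and the GPS extended Skorokhod map is $\overline\Gamma(\psi)=\varphi$; it is Lipschitz continuous for uniform convergence on compact sets. *)

(* Defs.v *)
From mathcomp Require Import all_boot all_order all_algebra.
From mathcomp Require Import all_classical all_reals all_analysis.
Set Implicit Arguments.
Unset Strict Implicit.
Unset Printing Implicit Defensive.
Import Order.TTheory GRing.Theory Num.Theory numFieldNormedType.Exports.
Local Open Scope classical_set_scope.
Local Open Scope ring_scope.

Definition vle (R : realType) (J : nat) (x y : 'rV[R]_J) : Prop :=
  forall i, x 0 i <= y 0 i.

Definition orthant (R : realType) (J : nat) : set 'rV[R]_J :=
  [set x | vle 0 x].

(* Constraint directions are indexed by [option 'I_J]: [Some i] stands for a
   coordinate i and [None] for the extra index J+1. *)
Definition dir (R : realType) (J : nat) (beta : 'rV[R]_J)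
    (k : option 'I_J) : 'rV[R]_J :=
  if k is Some i then
    delta_mx 0 i -
      \sum_(j < J | j != i) (beta 0 j / (1 - beta 0 i)) *: delta_mx 0 j
  else \sum_(i < J) (Num.sqrt J%:R)^-1 *: delta_mx 0 i.

(* The index set I(x), for x in the orthant; at x = 0 it contains every
   index, [None] included. *)
Definition active (R : realType) (J : nat) (x : 'rV[R]_J) :
    pred (option 'I_J) :=
  fun k => if k is Some i then x 0 i == 0 else x == 0.

Definition dcone (R : realType) (J : nat) (beta x : 'rV[R]_J) : set 'rV[R]_J :=
  [set v | exists2 a : option 'I_J -> R, (forall k, 0 <= a k) &
           v = \sum_(k | active x k) a k *: dir beta k].

Definition boundary (T : topologicalType) (A : set T) : set T :=
  closure A `\` interior A.

(* [gps_projection beta x y] is the graph relation "y = pi(x)". *)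
Definition gps_projection (R : realType) (J : nat) (beta x y : 'rV[R]_J) :
    Prop :=
  (orthant x -> y = x) /\
  (~ orthant x -> boundary (@orthant R J) y /\ dcone beta y (y - x)).

(* Paths on [0, oo[ are represented by functions on the whole of R whose
   values at negative times are never used. *)
Definition cadlag (R : realType) (J : nat) (f : R -> 'rV[R]_J) : Prop :=
  (forall t, 0 <= t -> f s @[s --> t^'+] --> f t) /\
  (forall t, 0 < t -> cvg (f s @[s --> t^'-])).

Definition closed_convex_hull (R : realType) (J : nat) (A : set 'rV[R]_J) :
    set 'rV[R]_J :=
  closure (smallest (fun C : set 'rV[R]_J => convex_set C) A).

(* The increment condition is imposed for s < t only: for s = t the union is
   empty, as is its hull, while the increment is 0. The jump condition is
   imposed for t > 0 only: with eta(0-) = 0 it holds at t = 0, as eta(0) = 0. *)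
Definition solves_gps_ESP (R : realType) (J : nat) (beta : 'rV[R]_J)
    (psi phi eta : R -> 'rV[R]_J) : Prop :=
  [/\ cadlag phi, cadlag eta, phi 0 = psi 0 &
   forall t, 0 <= t ->
   [/\ phi t = psi t + eta t,
       orthant (phi t),
       (forall s, 0 <= s < t ->
          closed_convex_hull
            (\bigcup_(u in [set u | s < u <= t]) dcone beta (phi u))
            (eta t - eta s)) &
       (0 < t ->
          closed_convex_hull (dcone beta (phi t))
            (eta t - lim (eta s @[s --> t^'-])))]].

(* [gps_ESM beta psi phi] is the graph relation "phi is the image of psi under
   the GPS extended Skorokhod map". *)
Definition gps_ESM (R : realType) (J : nat) (beta : 'rV[R]_J)
    (psi phi : R -> 'rV[R]_J) : Prop :=
  exists eta, solves_gps_ESP beta psi phi eta.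

(* Main.v *)
(** Let [d_i] be the constraint directions, [d_i = (e_i - beta) / (1 - beta_i)],
    so that [nu . d_i] has the sign of [nu_i - m], where [m = nu . beta] is the
    weighted mean of [nu].  On the cube [0,1]^J consider, for [a, e > 0] with
    [2 a <= beta_i], the penalty
      [e (sum_k beta_k (nu_k - m)^+ + a m)]
    and let [h(D)] be the minimum over the cube of [nu . D + penalty].  A
    first-order perturbation of a minimizer [nu] at [D] shows that
    [nu_j < m] forces [D_j >= e a^2] and [nu_j > m] forces [D_j <= - e a^2].
    Take [D = phi - phi'].  If [phi] is pushed in direction [d_j] then
    [phi_j = 0 <= phi'_j], so [D_j <= 0], hence [nu_j >= m] and the push does
    not decrease [nu . D]; likewise for [phi'].  The term [a m] makes [nu = 0]
    the only minimizer at [D >= 0], which covers [phi' = 0], where the cone of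
    pushes is a half-space.  Because of the margin
    [e a^2] this persists for [D] near the point where [nu] is a minimizer.
    An increase of the input does not decrease [nu . D] either, as [nu >= 0].
    Hence [h] stays nonnegative along the paths (in one step for the
    projection, by real induction on time for the Skorokhod map); evaluating
    at [nu = e_i] and letting [e -> 0] gives [D_i >= 0]. *)
Require Import Defs.
From mathcomp Require Import all_boot all_order all_algebra.
From mathcomp Require Import all_classical all_reals all_analysis.
From mathcomp Require Import ring lra.
Import Order.TTheory GRing.Theory Num.Theory numFieldNormedType.Exports.
Local Open Scope classical_set_scope.
Local Open Scope ring_scope.

Definition dot {R : realType} {J : nat} (u v : 'rV[R]_J) : R :=
  \sum_i u 0 i * v 0 i.

(** Let [S] collect the times up to which [P] holds without interruption. If [P] failed at some
    time, [S] would be bounded; [P] then holds at [sup S] by the left step, and the right step goes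
    past it. *)
Lemma real_induction (R : realType) (P : R -> Prop) : P 0 ->
  (forall t, 0 <= t -> P t ->
     exists2 r, t < r & forall s, t <= s < r -> P s) ->
  (forall t, 0 < t -> (forall s, 0 <= s < t -> P s) -> P t) ->
  forall t, 0 <= t -> P t.
Proof.
move=> P0 right left t0 t0_ge0; apply: contrapT => nP.
pose S := [set s : R | 0 <= s /\ forall u, 0 <= u <= s -> P u].
have S0 : S 0.
  by split=> // u; rewrite -eq_le => /eqP <-.
have Sb s : S s -> s <= t0.
  move=> [s0 hs]; rewrite leNgt; apply/negP => ts.
  by apply/nP/hs; rewrite t0_ge0 ltW.
have hS : has_sup S by split; [exists 0|exists t0].
have tau0 : 0 <= sup S by exact: sup_upper_bound hS _ S0.
have below s : 0 <= s < sup S -> P s.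
  move=> /andP[s0 st].
  have [||u [_ hu] su] := @sup_adherent _ S (sup S - s); rewrite ?subr_gt0//.
  by apply: hu; rewrite s0 ltW//; lra.
have Pt : P (sup S).
  move: tau0; rewrite le_eqVlt => /predU1P[<-//|tau0]; exact: left.
have [r tr hr] := right _ tau0 Pt.
have : S ((sup S + r) / 2).
  split=> [|u /andP[u0 ur]]; first lra.
  have [us|us] := ltP u (sup S); first by apply: below; rewrite u0.
  by apply: hr; rewrite us; lra.
move=> /(sup_upper_bound hS); lra.
Qed.

(** * Inner product on row vectors *)

Section Dot.
Context {R : realType} {J : nat}.
Implicit Types (u v w : 'rV[R]_J).

Lemma dotC u v : dot u v = dot v u.
Proof. by apply: eq_bigr => i _; rewrite mulrC. Qed.

Lemma dotDr w u v : dot w (u + v) = dot w u + dot w v.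
Proof. by rewrite -big_split; apply: eq_bigr => i _; rewrite mxE mulrDr. Qed.

Lemma dotZr w a u : dot w (a *: u) = a * dot w u.
Proof. by rewrite mulr_sumr; apply: eq_bigr => i _; rewrite mxE; ring. Qed.

Lemma dotNr w u : dot w (- u) = - dot w u.
Proof. by rewrite -scaleN1r dotZr mulN1r. Qed.

Lemma dotBr w u v : dot w (u - v) = dot w u - dot w v.
Proof. by rewrite dotDr dotNr. Qed.

Lemma dot0r w : dot w 0 = 0.
Proof. by apply: big1 => i _; rewrite mxE mulr0. Qed.

Lemma dot_sumr (I : finType) (P : pred I) (F : I -> 'rV[R]_J) w :
  dot w (\sum_(i | P i) F i) = \sum_(i | P i) dot w (F i).
Proof. exact: (big_morph (dot w) (dotDr w) (dot0r w)). Qed.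

Lemma dot_deltar w j : dot w (delta_mx 0 j) = w 0 j.
Proof.
rewrite /dot (bigD1 j)//= mxE !eqxx mulr1 big1 ?addr0// => i /negbTE ij.
by rewrite mxE ij andbF mulr0.
Qed.

Lemma dot_bumpl u t j v : dot (u + t *: delta_mx 0 j) v = dot u v + t * v 0 j.
Proof. by rewrite dotC dotDr dotZr dot_deltar dotC. Qed.

Lemma dot_ge0 u v : vle 0 u -> vle 0 v -> 0 <= dot u v.
Proof.
move=> u0 v0; apply: sumr_ge0 => i _.
by have := u0 i; have := v0 i; rewrite mxE => *; apply: mulr_ge0.
Qed.

Lemma dot_continuous w : continuous (dot w).
Proof.
apply: (@continuous_big _ _ +%R 0) => [|i _ v].
  exact: add_continuous.
exact: (cvgM (cvg_cst (w 0 i)) (@coord_continuous R 1 J 0 i v)).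
Qed.

End Dot.

(** * Deviation from the weighted mean *)

Section Potential.
Context {R : realType} {J : nat} (beta : 'rV[R]_J).
Hypothesis beta_pos : forall i, 0 < beta 0 i.
Hypothesis beta_lt1 : forall i, beta 0 i < 1.
Hypothesis beta_sum : \sum_i beta 0 i = 1.
Implicit Types (nu D x y v : 'rV[R]_J).

Definition cube : set 'rV[R]_J := [set nu | forall i, 0 <= nu 0 i <= 1].

(** As the weights sum to 1, this is half the weighted mean absolute deviation of [nu]. *)
Definition deviation nu : R :=
  \sum_k beta 0 k * Num.max (nu 0 k - dot nu beta) 0.

Lemma sum_centered nu : \sum_k beta 0 k * (nu 0 k - dot nu beta) = 0.
Proof.
under eq_bigr do rewrite mulrBr.
rewrite big_split /= sumrN -mulr_suml beta_sum mul1r.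
by rewrite -/(dot beta nu) dotC subrr.
Qed.

(** Positive and negative parts differ by the centered entries, whose weighted sum vanishes. This
    makes [deviation] invariant under negation. *)
Lemma deviationE nu :
  deviation nu = \sum_k beta 0 k * Num.max (dot nu beta - nu 0 k) 0.
Proof.
rewrite -[RHS]addr0 -[X in _ = _ + X](sum_centered nu) -big_split /=.
apply: eq_bigr => k _; rewrite -mulrDr; congr (_ * _).
by rewrite /Order.max; case: ifP; case: ifP => *; lra.
Qed.

Lemma deviation_ge0 nu : 0 <= deviation nu.
Proof.
apply: sumr_ge0 => k _; apply: mulr_ge0; first exact: ltW.
by rewrite le_max lexx orbT.
Qed.

Lemma deviation_eq0 nu : (forall k, nu 0 k <= dot nu beta) -> deviation nu = 0.
Proof.
by move=> h; apply: big1 => k _; rewrite max_r ?mulr0// subr_le0.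
Qed.

Lemma above_mean nu j : nu 0 j < dot nu beta ->
  exists k, dot nu beta < nu 0 k.
Proof.
move=> hj; apply: contrapT => h.
have hle k : nu 0 k <= dot nu beta.
  by rewrite leNgt; apply/negP => hk; apply: h; exists k.
have hz : \sum_k beta 0 k * (dot nu beta - nu 0 k) = 0.
  under eq_bigr do rewrite -opprB mulrN.
  by rewrite sumrN sum_centered oppr0.
have pos k : true -> 0 <= beta 0 k * (dot nu beta - nu 0 k).
  by move=> _; apply: mulr_ge0; [exact: ltW|rewrite subr_ge0].
have /eqP := psumr_eq0P pos hz (i := j) isT.
by rewrite mulf_eq0 !gt_eqF// subr_gt0.
Qed.

Lemma below_mean nu j : dot nu beta < nu 0 j ->
  exists k, nu 0 k < dot nu beta.
Proof.
move=> hj; have [|k] := @above_mean (- nu) j.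
  by rewrite dotC dotNr dotC mxE ltrN2.
by rewrite dotC dotNr dotC mxE ltrN2; exists k.
Qed.

(* Raising [nu j] moves the weighted mean up, closer to every entry above it,
   while the entry [j] itself stays below and does not contribute. *)
Lemma deviation_raise nu j k t : 0 <= t ->
  nu 0 j + t <= dot nu beta -> dot nu beta + t <= nu 0 k ->
  deviation (nu + t *: delta_mx 0 j) <=
  deviation nu - t * beta 0 j * beta 0 k.
Proof.
move=> t0 tj tk; have bj := beta_pos j; have bk := beta_pos k.
have b1 := beta_lt1 j.
have tb : 0 <= t * beta 0 j by apply: mulr_ge0 => //; apply: ltW.
have tb1 : t * beta 0 j <= t by rewrite ler_piMr// ltW.
have [E|kj] := eqVneq k j.
  have t00 : t = 0 by move: tk; rewrite E; lra.
  by rewrite t00 scale0r addr0 !mul0r subr0.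
rewrite /deviation dot_bumpl (bigD1 k)//= [X in _ <= X - _](bigD1 k)//=.
rewrite addrAC; apply: lerD.
  rewrite !mxE (negbTE kj) eqxx /= mulr0 addr0.
  rewrite !max_l; [|lra|lra].
  by rewrite [t * _ * _]mulrC -mulrBr ler_pM2l//; lra.
apply: ler_sum => i ik; rewrite ler_pM2l// !mxE eqxx /=.
case: eqVneq => [->|ij]; last first.
  by rewrite mulr0 addr0 ge_max !le_max lexx !orbT andbT; apply/orP; left; lra.
by rewrite mulr1 [X in X <= _]max_r ?le_max ?lexx ?orbT//; lra.
Qed.

Lemma deviation_opp nu : deviation (- nu) = deviation nu.
Proof.
rewrite deviationE dotC dotNr dotC; apply: eq_bigr => k _; rewrite mxE.
by rewrite opprK addrC.
Qed.


Lemma dot_dir nu i :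
  dot nu (dir beta (Some i)) = (nu 0 i - dot nu beta) / (1 - beta 0 i).
Proof.
have b1 : 1 - beta 0 i != 0 by have := beta_lt1 i; rewrite subr_eq0 => /gt_eqF ->.
rewrite dotBr dot_deltar dot_sumr [dot nu beta](bigD1 i)//=.
under eq_bigr => j _.
  rewrite dotZr dot_deltar mulrAC [beta 0 j * _]mulrC; over.
by rewrite -mulr_suml; field.
Qed.

(** * Penalized potential and first-order conditions at its minimizers *)

Section Minimizer.
Variables (a e : R).
Hypotheses (a_gt0 : 0 < a) (a_le : forall i, a + a <= beta 0 i) (e_gt0 : 0 < e).

Definition potential D nu : R :=
  dot nu D + e * (deviation nu + a * dot nu beta).

Definition minimizer D nu : Prop :=
  cube nu /\ forall nu', cube nu' -> potential D nu <= potential D nu'.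

Lemma minimizer_exists D : exists nu, minimizer D nu.
Proof.
have cdot u : continuous (dot^~ u : 'rV[R]_J -> R).
  by rewrite (_ : dot^~ u = dot u); [exact: dot_continuous|
    apply/funext => w; rewrite dotC].
have cdev : continuous deviation.
  apply: (@continuous_big _ _ +%R 0) => [|k _ v].
    exact: add_continuous.
  have c1 : (fun w : 'rV[R]_J => w 0 k - dot w beta) @ v -->
      v 0 k - dot v beta.
    exact: (cvgB (@coord_continuous R 1 J 0 k v) (cdot beta v)).
  have c2 : (fun _ : 'rV[R]_J => (0 : R)) @ v --> (0 : R).
    exact: (cvg_cst (0 : R) (FF := nbhs_filter v)).
  exact: (cvgM (cvg_cst (beta 0 k)) (continuous_max c1 c2)).
have c0 : cube 0 by move=> i; rewrite mxE lexx ler01.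
have cc : compact cube.
  have := @rV_compact R J (fun=> `[0, 1]%classic : set R)
    (fun=> @segment_compact R 0 1).
  by congr compact; apply/seteqP; split => v /= h i; have := h i;
    rewrite ?in_itv.
have cp : continuous (potential D).
  move=> v; apply: (cvgD (cdot D v)); apply: (cvgM (cvg_cst e)).
  exact: (cvgD (cdev v) (cvgM (cvg_cst a) (cdot beta v))).
have [||nu /set_mem cnu h] := @compact_EVT_min _ R (potential D) cube _ cc.
- by exists 0.
- exact: continuous_subspaceT.
by exists nu; split => // nu' cnu'; apply: h; apply: mem_set.
Qed.

(** Raising entry [j] by [t] lowers the deviation by at least [t * beta_j * beta_k] and adds
    [t * a * beta_j] to the linear term, so minimality gives [D_j >= e * beta_j * (beta_k - a)]. *)
Lemma minimizer_below D nu j : minimizer D nu ->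
  nu 0 j < dot nu beta -> e * a * a <= D 0 j.
Proof.
move=> [cnu min] hj; have [k hk] := above_mean _ _ hj.
(* The largest [t] for which [nu_j + t] does not pass the mean and the mean plus [t] does not pass
   [nu_k]. The raised entry is then below [nu_k <= 1], hence still in the cube. *)
pose t := Num.min (dot nu beta - nu 0 j) (nu 0 k - dot nu beta).
have t0 : 0 < t by rewrite lt_min !subr_gt0 hj.
have tj : nu 0 j + t <= dot nu beta by rewrite addrC -lerBrDr ge_min lexx.
have tk : dot nu beta + t <= nu 0 k.
  by rewrite addrC -lerBrDr ge_min lexx orbT.
have dev := deviation_raise _ _ _ _ (ltW t0) tj tk.
have cu : cube (nu + t *: delta_mx 0 j).
  move=> i; rewrite !mxE eqxx /=; have /andP[ci0 ci1] := cnu i.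
  case: eqVneq => [->|_]; last by rewrite mulr0 addr0 ci0.
  have /andP[cj0 cj1] := cnu j; have /andP[ck0 ck1] := cnu k.
  by rewrite mulr1; apply/andP; split; lra.
have edev := ler_wpM2l (ltW e_gt0) dev.
have := min _ cu; rewrite /potential !dot_bumpl => hmin.
have a0 := a_gt0; have bj := a_le j; have bk := a_le k; have bj0 := beta_pos j.
have hb : a * a <= beta 0 j * (beta 0 k - a).
  have bj2 : a <= beta 0 j by lra.
  have bk2 : a <= beta 0 k - a by lra.
  exact: ler_pM (ltW a_gt0) (ltW a_gt0) bj2 bk2.
have {}hmin : 0 <= t * (D 0 j - e * (beta 0 j * (beta 0 k - a))) by lra.
have {}hmin : 0 <= D 0 j - e * (beta 0 j * (beta 0 k - a)).
  by rewrite pmulr_rge0 in hmin.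
rewrite -mulrA; apply: le_trans (ler_wpM2l (ltW e_gt0) hb) _; lra.
Qed.

(** Mirror image: entry [j] is lowered, which amounts to raising an entry of [- nu]. The linear term
    now decreases too, whence the factor [beta_k + a]. *)
Lemma minimizer_above D nu j : minimizer D nu ->
  dot nu beta < nu 0 j -> D 0 j <= - (e * a * a).
Proof.
move=> [cnu min] hj; have [k hk] := below_mean _ _ hj.
pose t := Num.min (nu 0 j - dot nu beta) (dot nu beta - nu 0 k).
have t0 : 0 < t by rewrite lt_min !subr_gt0 hj.
have tj : t <= nu 0 j - dot nu beta by rewrite ge_min lexx.
have tk : t <= dot nu beta - nu 0 k by rewrite ge_min lexx orbT.
have dev : deviation (nu + - t *: delta_mx 0 j) <=
    deviation nu - t * beta 0 j * beta 0 k.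
  rewrite -[X in X <= _]deviation_opp -[deviation nu]deviation_opp.
  rewrite opprD scaleNr opprK.
  have E : dot (- nu) beta = - dot nu beta by rewrite dotC dotNr dotC.
  by apply: deviation_raise; rewrite ?E ?mxE; lra.
have cu : cube (nu + - t *: delta_mx 0 j).
  move=> i; rewrite !mxE eqxx /=; have /andP[ci0 ci1] := cnu i.
  case: eqVneq => [->|_]; last by rewrite mulr0 addr0 ci0.
  have /andP[cj0 cj1] := cnu j; have /andP[ck0 ck1] := cnu k.
  by rewrite mulr1; apply/andP; split; lra.
have edev := ler_wpM2l (ltW e_gt0) dev.
have := min _ cu; rewrite /potential !dot_bumpl => hmin.
have a0 := a_gt0; have bj := a_le j; have bk := a_le k; have bj0 := beta_pos j.
have hb : a * a <= beta 0 j * (beta 0 k + a).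
  have bj2 : a <= beta 0 j by lra.
  have bk2 : a <= beta 0 k + a by lra.
  exact: ler_pM (ltW a_gt0) (ltW a_gt0) bj2 bk2.
have {}hmin : 0 <= t * (- D 0 j - e * (beta 0 j * (beta 0 k + a))) by lra.
have {}hmin : 0 <= - D 0 j - e * (beta 0 j * (beta 0 k + a)).
  by rewrite pmulr_rge0 in hmin.
rewrite -mulrA lerNr; apply: le_trans (ler_wpM2l (ltW e_gt0) hb) _; lra.
Qed.

(** No entry can exceed the mean, so [nu] is constant; the linear penalty then excludes a positive
    constant. *)
Lemma minimizer_eq0 D nu : minimizer D nu ->
  (forall j, - (e * a * a) < D 0 j) -> nu = 0.
Proof.
move=> mnu hD; have [cnu min] := mnu.
have le_m k : nu 0 k <= dot nu beta.
  rewrite leNgt; apply/negP => /(minimizer_above _ _ _ mnu).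
  by rewrite leNgt hD.
have eq_m k : nu 0 k = dot nu beta.
  apply/eqP; rewrite eq_le le_m leNgt; apply/negP => /above_mean[i].
  by rewrite ltNge le_m.
have c0 : cube 0 by move=> i; rewrite mxE lexx ler01.
have := min _ c0; rewrite /potential deviation_eq0// dotC [X in _ <= X + _]dotC.
rewrite [dot 0 beta]dotC !dot0r deviation_eq0; last first.
  by move=> k; rewrite mxE dotC dot0r.
rewrite mulr0 !add0r mulr0 => hle; apply/rowP => k; rewrite eq_m [RHS]mxE.
apply/eqP; rewrite eq_le -{2}(eq_m k); have /andP[-> _] := cnu k; rewrite andbT.
have J0 : (0 < J)%N by apply: leq_ltn_trans (ltn_ord k).
have a0 := a_gt0; have e0 := e_gt0.
have Ja : J%:R * a <= 1.
  rewrite mulr_natl -beta_sum -[X in _ *+ X]card_ord -sumr_const.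
  apply: ler_sum => i _.
  have := a_le i; have := a_gt0; lra.
have [//|m0] := lerP (dot nu beta) 0.
have sD : - (e * a) < \sum_j D 0 j.
  have : \sum_(j < J) - (e * a * a) < \sum_j D 0 j.
    by apply: ltr_sum => //; rewrite has_predT /index_enum -enumT size_enum_ord.
  apply: le_lt_trans; rewrite sumr_const card_ord -mulr_natl.
  have := ler_wpM2l (ltW (mulr_gt0 e_gt0 a_gt0)) Ja; lra.
(* At a constant [nu] the potential is the common value times [\sum_j D_j + e * a], a positive
   factor by [sD]. *)
have {}hle : dot nu beta * (\sum_j D 0 j + e * a) <= 0.
  have E : dot D nu = dot nu beta * \sum_j D 0 j.
    by rewrite mulr_sumr; apply: eq_bigr => i _; rewrite eq_m mulrC.
  rewrite mulrDr -E; lra.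
rewrite pmulr_rle0 // in hle; lra.
Qed.

(** The slack between [D] and [x - y] lets one fixed minimizer control the pushes at all nearby
    positions. *)
Lemma dcone_pairing D nu x y : minimizer D nu -> vle 0 x -> vle 0 y ->
  (forall j, `|D 0 j - (x - y) 0 j| < e * a * a) ->
  dcone beta x `<=` [set v | 0 <= dot nu v] /\
  dcone beta y `<=` [set v | 0 <= dot (- nu) v].
Proof.
move=> mnu x0 y0 near_D; have [cnu _] := mnu.
have {}x0 j : 0 <= x 0 j by have := x0 j; rewrite mxE.
have {}y0 j : 0 <= y 0 j by have := y0 j; rewrite mxE.
have bnd j : - (e * a * a) < D 0 j - (x 0 j - y 0 j) < e * a * a.
  by have := near_D j; rewrite ltr_norml !mxE.
have b1 j : 0 < 1 - beta 0 j by rewrite subr_gt0.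
split=> v [c c0 ->] /=; rewrite dot_sumr; apply: sumr_ge0 => -[i|] /=.
- move=> /eqP xi; rewrite dotZr dot_dir mulr_ge0// divr_ge0 ?(ltW (b1 _))//.
  rewrite subr_ge0 leNgt; apply/negP => /(minimizer_below _ _ _ mnu).
  have := bnd i; rewrite xi; have := y0 i => *; lra.
(* The extra direction has nonnegative entries, and so has [nu]. *)
- move=> _; rewrite dotZr mulr_ge0// dot_sumr sumr_ge0// => i _.
  rewrite dotZr dot_deltar mulr_ge0 ?invr_ge0 ?sqrtr_ge0//.
  by have /andP[] := cnu i.
- move=> /eqP yi; rewrite dotZr dotC dotNr dotC dot_dir mulr_ge0// -mulNr.
  rewrite divr_ge0 ?(ltW (b1 _))// opprB.
  rewrite subr_ge0 leNgt; apply/negP => /(minimizer_above _ _ _ mnu).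
  have := bnd i; rewrite yi; have := x0 i => *; lra.
(* For [y = 0] the extra direction would pair with the wrong sign, but here [D] is close to
   [x >= 0], which forces [nu = 0]. *)
move=> /eqP y00; have -> : nu = 0.
  apply: (minimizer_eq0 _ _ mnu) => j.
  by have := bnd j; rewrite y00 mxE; have := x0 j => *; lra.
by rewrite oppr0 dotC dot0r.
Qed.

Definition potential_nneg D : Prop :=
  forall nu, cube nu -> 0 <= potential D nu.

Lemma penalty_ge0 nu : cube nu -> 0 <= e * (deviation nu + a * dot nu beta).
Proof.
move=> cnu; apply: mulr_ge0; first exact: ltW.
apply: addr_ge0; first exact: deviation_ge0.
apply: mulr_ge0; first exact: ltW.
by apply: dot_ge0 => i; rewrite mxE; [have /andP[] := cnu i|exact: ltW].
Qed.

Lemma minimizer_potential D nu : minimizer D nu ->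
  0 <= potential D nu -> potential_nneg D.
Proof. by move=> [_ min] p0 w cw; exact: le_trans (min _ cw). Qed.

Lemma cube_ge0 nu : cube nu -> vle 0 nu.
Proof. by move=> cnu i; rewrite mxE; have /andP[] := cnu i. Qed.

Lemma vle_potential D : vle 0 D -> potential_nneg D.
Proof.
move=> D0 nu cnu; apply: addr_ge0; last exact: penalty_ge0.
by apply: dot_ge0 => //; exact: cube_ge0.
Qed.

Lemma near_self D : forall j, `|D 0 j - D 0 j| < e * a * a.
Proof. by move=> j; rewrite subrr normr0 !mulr_gt0. Qed.

(** * Comparison for the projection *)

Lemma projection_potential nu' nu p' p :
  gps_projection beta nu' p' -> gps_projection beta nu p ->
  vle nu' nu -> potential_nneg (p - p').
Proof.
(* Both cases of the projection in one form; in the boundary case [r] lies in the orthant because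
   the orthant is closed. *)
have spec q r : gps_projection beta q r -> vle 0 r /\ dcone beta r (r - q).
  move=> [h1 h2]; have [oq|noq] := pselect (orthant q).
    rewrite h1// subrr; split => //; exists (fun=> 0) => //.
    by rewrite big1// => k _; rewrite scale0r.
  have [[cr _] dr] := h2 noq; split => // i; rewrite mxE.
  have cl : closed [set v : 'rV[R]_J | 0 <= v 0 i].
    apply: (@preimage_closed _ _ (fun v : 'rV[R]_J => v 0 i) [set z | 0 <= z]).
      by move=> v _; exact: coord_continuous.
    exact: closed_ge.
  suff : closure [set v : 'rV[R]_J | 0 <= v 0 i] r.
    by rewrite -((closure_id _).1 cl).
  by apply: closureS cr => v /(_ i); rewrite mxE.
move=> /spec[p'0 dp'] /spec[p0 dp] le_nu.
have [w mw] := minimizer_exists (p - p'); have [cw _] := mw.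
have [hx hy] := dcone_pairing _ _ _ _ mw p0 p'0 (near_self _).
apply: (minimizer_potential _ _ mw); apply: addr_ge0; last exact: penalty_ge0.
have -> : p - p' = (p - nu) - (p' - nu') + (nu - nu').
  by apply/rowP => i; rewrite !mxE; ring.
rewrite dotDr dotBr; apply: addr_ge0.
  have := hx _ dp; have := hy _ dp'; rewrite /= dotC dotNr dotC; lra.
apply: dot_ge0; first exact: cube_ge0.
by move=> i; rewrite !mxE subr_ge0.
Qed.

(** * Comparison for the Skorokhod map *)

Lemma hull_halfspace (w : 'rV[R]_J) (A : set 'rV[R]_J) :
  A `<=` [set v | 0 <= dot w v] ->
  closed_convex_hull A `<=` [set v | 0 <= dot w v].
Proof.
move=> hA.
have cl : closed [set v : 'rV[R]_J | 0 <= dot w v].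
  apply: (@preimage_closed _ _ (dot w) [set z | 0 <= z]).
    by move=> v _; exact: dot_continuous.
  exact: closed_ge.
rewrite [X in _ `<=` X]((closure_id _).1 cl); apply: closureS.
apply: smallest_sub => // x y l /set_mem /= hx /set_mem /= hy.
apply/mem_set => /=; rewrite /conv /= dotDr !dotZr.
by rewrite addr_ge0// mulr_ge0// subr_ge0.
Qed.

Section ESP.
Variables (psi' psi phi' phi eta' eta Delta : R -> 'rV[R]_J).
Hypothesis esp' : solves_gps_ESP beta psi' phi' eta'.
Hypothesis esp : solves_gps_ESP beta psi phi eta.
Hypothesis Delta_mono :
  forall s t : R, 0 <= s -> s <= t -> vle (Delta s) (Delta t).
Hypothesis Delta0 : vle 0 (Delta 0).
Hypothesis psiE : forall t : R, 0 <= t -> psi t = psi' t + Delta t.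

Let D t := phi t - phi' t.

(** The difference of the two sides is the pairing of [nu >= 0] with an increment of [Delta]. *)
Lemma gap_increment nu s t : cube nu -> 0 <= s -> s <= t ->
  dot nu (eta t - eta s) - dot nu (eta' t - eta' s) <=
  dot nu (D t) - dot nu (D s).
Proof.
move=> cnu s0 st; have t0 := le_trans s0 st.
have [_ _ _ h'] := esp'; have [_ _ _ h] := esp.
have [e1 _ _ _] := h _ t0; have [e2 _ _ _] := h _ s0.
have [e3 _ _ _] := h' _ t0; have [e4 _ _ _] := h' _ s0.
have E : dot nu (D t) - dot nu (D s) = dot nu (Delta t - Delta s) +
    (dot nu (eta t - eta s) - dot nu (eta' t - eta' s)).
  rewrite -!dotBr -dotDr; congr dot.
  rewrite /D e1 e2 e3 e4 !psiE//.
  by apply/rowP => i; rewrite !mxE; ring.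
rewrite E lerDr; apply: dot_ge0; first exact: cube_ge0.
by move=> i; rewrite !mxE subr_ge0; exact: Delta_mono.
Qed.

Lemma gap_right t : 0 <= t -> potential_nneg (D t) ->
  exists2 r, t < r & forall s, t <= s < r -> potential_nneg (D s).
Proof.
move=> t0 Pt; have [[cphi' _] _ _ h'] := esp'; have [[cphi _] _ _ h] := esp.
(* Half the margin, so that by the triangle inequality any two values of [D] shortly after [t]
   differ by less than [e * a * a]. *)
have del0 : 0 < e * a * a / 2 by rewrite !divr_gt0 ?mulr_gt0.
have cD : D s @[s --> t^'+] --> D t by apply: cvgB; [exact: cphi|exact: cphi'].
have : nbhs t (fun u => t < u -> ball (D t) (e * a * a / 2) (D u)).
  exact: (cvg_ball cD del0).
rewrite -nbhs_ballE => -[r /= r0 hr].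
exists (t + r) => [|s /andP[ts sr]]; first by rewrite ltrDl.
have hD u : t < u <= s -> forall j, `|D t 0 j - D u 0 j| < e * a * a / 2.
  move=> /andP[tu us] j.
  have := hr u; rewrite /ball/= /ball_ /= => hu.
  have [|_] // := hu _ tu; last exact.
  by rewrite ler0_norm ?subr_le0 ?ltW//; lra.
move: ts; rewrite le_eqVlt => /predU1P[<-//|ts].
(* The minimizer is taken at the final time [s] and kept fixed on []t, s]]: its potential is
   nonnegative at [D t] and does not decrease up to [D s]. *)
have [w mw] := minimizer_exists (D s); have [cw _] := mw.
have pair u : t < u <= s -> dcone beta (phi u) `<=` [set v | 0 <= dot w v] /\
    dcone beta (phi' u) `<=` [set v | 0 <= dot (- w) v].
  move=> tus; have u0 : 0 <= u by case/andP: tus => tu _; apply: le_trans (ltW tu).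
  have [_ o _ _] := h _ u0; have [_ o' _ _] := h' _ u0.
  apply: (dcone_pairing _ _ _ _ mw o o') => j.
  have := hD u tus j; have := hD s _ j; rewrite ts lexx => /(_ isT).
  rewrite !ltr_norml -/(D u) => /andP[? ?] /andP[? ?]; apply/andP; split; lra.
apply: (minimizer_potential _ _ mw); apply: le_trans (Pt _ cw) _.
rewrite /potential lerD2r -subr_ge0.
apply: le_trans (gap_increment _ _ _ cw t0 (ltW ts)).
have s0 : 0 <= s by apply: le_trans (ltW ts).
have t0s : 0 <= t < s by rewrite t0.
have [_ _ /(_ _ t0s) hs _] := h _ s0; have [_ _ /(_ _ t0s) hs' _] := h' _ s0.
have := hull_halfspace w _ _ _ hs => /(_ _)/=.
have := hull_halfspace (- w) _ _ _ hs' => /(_ _)/=.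
rewrite dotC dotNr dotC oppr_ge0 subr_ge0 => h2 h1.
apply: le_trans (h2 _) (h1 _).
- by move=> v [u tu]; case: (pair u tu) => _; exact.
- by move=> v [u tu]; case: (pair u tu) => + _; exact.
Qed.

Lemma gap_left t : 0 < t -> (forall s, 0 <= s < t -> potential_nneg (D s)) ->
  potential_nneg (D t).
Proof.
move=> t0 Ps; have [_ [_ ceta'] _ h'] := esp'; have [_ [_ ceta] _ h] := esp.
have [_ o _ /(_ t0) j] := h _ (ltW t0); have [_ o' _ /(_ t0) j'] := h' _ (ltW t0).
have [w mw] := minimizer_exists (D t); have [cw _] := mw.
have [hx hy] := dcone_pairing _ _ _ _ mw o o' (near_self _).
have {}hx := hull_halfspace _ _ hx _ j; have {}hy := hull_halfspace _ _ hy _ j'.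
apply: (minimizer_potential _ _ mw).
(* As [s] increases to [t], [f s] tends to the pairing of [w] with the difference of the jumps,
   nonnegative by the jump conditions, while [f s <= potential (D t) w] by the hypothesis at [s]. *)
pose f s := dot w (eta t - eta s) - dot w (eta' t - eta' s).
have cf : f s @[s --> t^'-] --> dot w (eta t - lim (eta s @[s --> t^'-])) -
    dot w (eta' t - lim (eta' s @[s --> t^'-])).
  apply: cvgB.
    apply: (cvg_comp (fun s => eta t - eta s) (dot w)); last exact: dot_continuous.
    by apply: cvgB; [exact: cvg_cst|exact: ceta].
  apply: (cvg_comp (fun s => eta' t - eta' s) (dot w)); last exact: dot_continuous.
  by apply: cvgB; [exact: cvg_cst|exact: ceta'].
have : dot w (eta t - lim (eta s @[s --> t^'-])) -
    dot w (eta' t - lim (eta' s @[s --> t^'-])) <= potential (D t) w.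
  apply: (@closed_cvg _ _ _ _ f (fun z => z <= potential (D t) w) _ _ _ cf).
    exact: closed_le.
  near=> s.
  have s0 : 0 < s by near: s; exact: nbhs_left_gt.
  have st : s < t by near: s; exact: nbhs_left_lt.
  have := gap_increment _ _ _ cw (ltW s0) (ltW st).
  have := Ps s; rewrite (ltW s0) st => /(_ isT _ cw).
  rewrite /potential /f => *; lra.
apply: le_trans; rewrite subr_ge0; apply: le_trans hx.
by move: hy; rewrite /= dotC dotNr dotC oppr_ge0.
Unshelve. all: by end_near.
Qed.

Lemma gap_potential t : 0 <= t -> potential_nneg (D t).
Proof.
move: t; apply: real_induction; [|exact: gap_right|exact: gap_left].
have [_ _ e1 _] := esp; have [_ _ e2 _] := esp'.
rewrite /D e1 e2 psiE// addrC addKr; exact: vle_potential.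
Qed.

End ESP.
End Minimizer.

(** * Removal of the penalty *)

Lemma potential_vle a D : 0 < a ->
  (forall e, 0 < e -> potential_nneg a e D) -> vle 0 D.
Proof.
move=> a0 h i; rewrite mxE; apply/ler_addgt0Pr => eps eps0.
pose w : 'rV[R]_J := delta_mx 0 i.
have cw : cube w.
  by move=> k; rewrite mxE eqxx /=; case: eqP; rewrite ?lexx ?ler01.
pose C := deviation w + a * dot w beta.
have C0 : 0 <= C.
  apply: addr_ge0; first exact: deviation_ge0.
  by rewrite mulr_ge0 ?ltW// dotC dot_deltar.
have C1 : 0 < C + 1 by lra.
(* This choice makes the penalty [e * C] at most [eps]; adding 1 guards against [C = 0]. *)
have := h (eps / (C + 1)) (divr_gt0 eps0 C1) w cw.
rewrite /potential -/C {1}/w dotC dot_deltar => h1.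
apply: le_trans h1 _; rewrite lerD2l mulrAC ler_pdivrMr// ler_wpM2l ?ltW//; lra.
Qed.

End Potential.

Theorem theorem3p2 (R : realType) (J : nat) (hJ : (2 <= J)%N)
    (beta : 'rV[R]_J) (hbeta : forall i, 0 < beta 0 i < 1)
    (hsum : \sum_(i < J) beta 0 i = 1) :
  (forall nu' nu p' p : 'rV[R]_J,
      gps_projection beta nu' p' -> gps_projection beta nu p ->
      vle nu' nu -> vle p' p) /\
  (forall psi' psi phi' phi : R -> 'rV[R]_J,
      cadlag psi' -> cadlag psi -> orthant (psi' 0) -> orthant (psi 0) ->
      gps_ESM beta psi' phi' -> gps_ESM beta psi phi ->
      (exists Delta : R -> 'rV[R]_J,
         [/\ forall s t : R, 0 <= s -> s <= t -> vle (Delta s) (Delta t),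
             vle 0 (Delta 0) &
             forall t : R, 0 <= t -> psi t = psi' t + Delta t]) ->
      forall t : R, 0 <= t -> vle (phi' t) (phi t)).
Proof.
have J0 : (0 < J)%N by apply: leq_trans hJ.
have b0 i : 0 < beta 0 i by case/andP: (hbeta i).
have b1 i : beta 0 i < 1 by case/andP: (hbeta i).
(* Half the smallest weight serves as [a]. *)
have [a a0 ha] : exists2 a : R, 0 < a & forall i, a + a <= beta 0 i.
  pose i0 := Ordinal J0.
  pose m := beta 0 [arg min_(i < i0) beta 0 i]%O.
  exists (m / 2); first by rewrite divr_gt0 // /m b0.
  move=> i; rewrite -splitr /m; case: arg_minP => // k _; exact.
have sub (p' p : 'rV[R]_J) : vle 0 (p - p') -> vle p' p.
  by move=> h i; have := h i; rewrite !mxE subr_ge0.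
split=> [nu' nu p' p hp' hp le_nu|psi' psi phi' phi _ _ _ _ [eta' h'] [eta h]
    [Delta [mono D0 psiE]] t t0].
  apply: sub; apply: (potential_vle _ b0 _ _ a0) => e e0.
  exact: (projection_potential _ b0 b1 hsum _ _ a0 ha e0 _ _ _ _ hp' hp le_nu).
apply: sub; apply: (potential_vle _ b0 _ _ a0) => e e0.
exact: (gap_potential _ b0 b1 hsum _ _ a0 ha e0 _ _ _ _ _ _ _ h' h mono D0 psiE).
Qed.
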